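(* Let $\tau,\sigma:\mathbb{Z}^2\to\mathbb{R}$ be nowhere vanishing and define $$H=\frac{\tau_1\tau_2}{\tau_{12}\tau},\quad A=\frac{\tau_1\sigma_1}{\tau_{11}\sigma},\quad B=\frac{\tau_2\sigma_2}{\tau_{22}\sigma},\quad K=\frac{\sigma_1\sigma_2}{\sigma_{12}\sigma},\quad P=\frac{\sigma_1\tau_1}{\sigma_{11}\tau},\quad Q=\frac{\sigma_2\tau_2}{\sigma_{22}\tau}.$$ Then the equations $$A_2=\frac{H_1}{K}A,\quad Q_1=\frac{K_2}{H}Q,\quad P_2=\frac{K_1}{H}P,\quad B_1=\frac{H_2}{K}B$$ hold identically; the discrete Demoulin equations $$\begin{aligned} H_{12}&=-\frac{K(H-1)(K_2-1)}{K[H(H_1-1)(H_2-1)-(H-1)](K_2-1)-AQH_1K_2(H_2-1)},\\ K_{12}&=-\frac{H(K-1)(H_1-1)}{H[K(K_1-1)(K_2-1)-(K-1)](H_1-1)-AQH_1K_2(K_1-1)} \end{aligned}$$ adopt the form $$\begin{aligned} \begin{vmatrix}\sigma_2&\sigma_{12}\\ \sigma_{22}&\sigma_{122}\end{vmatrix}\begin{vmatrix}\tau&\tau_1&\tau_{11}\\ \tau_2&\tau_{12}&\tau_{112}\\ \tau_{22}&\tau_{122}&\tau_{1122}\end{vmatrix}+\begin{vmatrix}\tau_2&\tau_{12}\\ \tau_{22}&\tau_{122}\end{vmatrix}\sigma_{12}^2\tau_{12}&=0,\\ \begin{vmatrix}\tau_1&\tau_{11}\\ \tau_{12}&\tau_{112}\end{vmatrix}\begin{vmatrix}\sigma&\sigma_2&\sigma_{22}\\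 \sigma_1&\sigma_{12}&\sigma_{122}\\ \sigma_{11}&\sigma_{112}&\sigma_{1122}\end{vmatrix}+\begin{vmatrix}\sigma_1&\sigma_{11}\\ \sigma_{12}&\sigma_{112}\end{vmatrix}\tau_{12}^2\sigma_{12}&=0; \end{aligned}$$ and the relations $$B=\frac{(H_2-1)(K-1)K_2}{(H-1)(K_2-1)H_2}Q,\qquad P=\frac{(H-1)(K_1-1)H_1}{(H_1-1)(K-1)K_1}A$$ read $$\begin{aligned} \begin{vmatrix}\tau&\tau_1\\ \tau_2&\tau_{12}\end{vmatrix}\begin{vmatrix}\sigma_2&\sigma_{22}\\ \sigma_{12}&\sigma_{122}\end{vmatrix}&=\begin{vmatrix}\sigma&\sigma_1\\ \sigma_2&\sigma_{12}\end{vmatrix}\begin{vmatrix}\tau_2&\tau_{22}\\ \tau_{12}&\tau_{122}\end{vmatrix},\\ \begin{vmatrix}\tau&\tau_1\\ \tau_2&\tau_{12}\end{vmatrix}\begin{vmatrix}\sigma_1&\sigma_{11}\\ \sigma_{12}&\sigma_{112}\end{vmatrix}&=\begin{vmatrix}\sigma&\sigma_1\\ \sigma_2&\sigma_{12}\end{vmatrix}\begin{vmatrix}\tau_1&\tau_{11}\\ \tau_{12}&\tau_{112}\end{vmatrix}. \end{aligned}$$ (''Adopt the form'' and ''read'' mean that the respective pairs of equations are equivalent.)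
   Context: For a function $h$ on $\mathbb{Z}^2$, $h_1(n_1,n_2)=h(n_1+1,n_2)$, $h_2(n_1,n_2)=h(n_1,n_2+1)$, and multiple subscripts denote repeated shifts, e.g. $h_{112}(n_1,n_2)=h(n_1+2,n_2+1)$. It is understood that $H\neq1$ and $K\neq1$ everywhere, so that the denominators appearing in the relations for $B$ and $P$ do not vanish; the discrete Demoulin equations include the requirement that their denominators are non-zero. *)

(* Defs.v *)
From mathcomp Require Import all_boot all_order all_algebra.
From mathcomp Require Import reals.

Set Implicit Arguments.
Unset Strict Implicit.
Unset Printing Implicit Defensive.

Import Order.TTheory GRing.Theory Num.Theory.
Local Open Scope ring_scope.

Section Shifts.
Variable R : Type.
Implicit Types (h : int * int -> R) (n : int * int).

Definition shift1 h : int * int -> R := fun n => h (n.1 + 1, n.2).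
Definition shift2 h : int * int -> R := fun n => h (n.1, n.2 + 1).

End Shifts.

Notation "h '\_1'" := (shift1 h) (at level 1, left associativity, format "h '\_1'").
Notation "h '\_2'" := (shift2 h) (at level 1, left associativity, format "h '\_2'").
Notation "h '\_11'" := (shift1 (shift1 h))
  (at level 1, left associativity, format "h '\_11'").
Notation "h '\_12'" := (shift1 (shift2 h))
  (at level 1, left associativity, format "h '\_12'").
Notation "h '\_22'" := (shift2 (shift2 h))
  (at level 1, left associativity, format "h '\_22'").
Notation "h '\_112'" := (shift1 (shift1 (shift2 h)))
  (at level 1, left associativity, format "h '\_112'").
Notation "h '\_122'" := (shift1 (shift2 (shift2 h)))
  (at level 1, left associativity, format "h '\_122'").
Notation "h '\_1122'" := (shift1 (shift1 (shift2 (shift2 h))))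
  (at level 1, left associativity, format "h '\_1122'").

Section Demoulin.
Variable R : realType.
Implicit Types (tau sigma H K A Q : int * int -> R) (n : int * int).

Definition potH tau : int * int -> R :=
  fun n => (tau\_1 n * tau\_2 n) / (tau\_12 n * tau n).
Definition potA tau sigma : int * int -> R :=
  fun n => (tau\_1 n * sigma\_1 n) / (tau\_11 n * sigma n).
Definition potB tau sigma : int * int -> R :=
  fun n => (tau\_2 n * sigma\_2 n) / (tau\_22 n * sigma n).
Definition potK sigma : int * int -> R :=
  fun n => (sigma\_1 n * sigma\_2 n) / (sigma\_12 n * sigma n).
Definition potP tau sigma : int * int -> R :=
  fun n => (sigma\_1 n * tau\_1 n) / (sigma\_11 n * tau n).
Definition potQ tau sigma : int * int -> R :=
  fun n => (sigma\_2 n * tau\_2 n) / (sigma\_22 n * tau n).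

Definition demoulin_denH H K A Q n : R :=
  K n * (H n * (H\_1 n - 1) * (H\_2 n - 1) - (H n - 1)) * (K\_2 n - 1)
  - A n * Q n * H\_1 n * K\_2 n * (H\_2 n - 1).

Definition demoulin_denK H K A Q n : R :=
  H n * (K n * (K\_1 n - 1) * (K\_2 n - 1) - (K n - 1)) * (H\_1 n - 1)
  - A n * Q n * H\_1 n * K\_2 n * (K\_1 n - 1).

(* Division by zero is total (x / 0 = 0), so the requirement that the
   denominator does not vanish is part of each equation. *)
Definition demoulin_eqH H K A Q n : Prop :=
  demoulin_denH H K A Q n != 0 /\
  H\_12 n = - ((K n * (H n - 1) * (K\_2 n - 1)) / demoulin_denH H K A Q n).

Definition demoulin_eqK H K A Q n : Prop :=
  demoulin_denK H K A Q n != 0 /\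
  K\_12 n = - ((H n * (K n - 1) * (H\_1 n - 1)) / demoulin_denK H K A Q n).

(* The square matrix with the given list of rows. *)
Definition rows_mx (m : nat) (s : seq (seq R)) : 'M[R]_m :=
  \matrix_(i < m, j < m) nth 0 (nth [::] s i) j.

Definition det2 (a b c d : R) : R :=
  \det (rows_mx 2 [:: [:: a; b];
                      [:: c; d]]).

Definition det3 (a b c d e f g h i : R) : R :=
  \det (rows_mx 3 [:: [:: a; b; c];
                      [:: d; e; f];
                      [:: g; h; i]]).

End Demoulin.

(* Main.v *)
Require Import Defs.
From mathcomp Require Import all_boot all_order all_algebra.
From mathcomp Require Import reals.
From mathcomp Require Import ring.

(** Each of [H] and [K] has the form [h_1 h_2 / (h_12 h)], so that subtracting
    [1] from it gives [- D / (h_12 h)], where [D = h h_12 - h_1 h_2] is a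
    two-by-two determinant of [h]. Multiplied by its denominator and with all
    terms on one side, the first Demoulin equation reads
    [H_12 * den + K (H - 1) (K_2 - 1) = 0].
    After the substitution the left-hand side is a nonvanishing monomial times
    [demoulin_form] (lemma [potH_equation_factor]). The three-by-three
    determinant comes from the Desnanot-Jacobi identity
    [tau_12 * det3 = D D_12 - D_1 D_2], where [D_1], [D_2], [D_12] are the
    shifts of the determinant [D] of [tau].

    Since the determinant equation says nothing about [den], recovering the
    Demoulin equation from it requires [den <> 0]. This is where [H <> 1] and
    [K <> 1] enter: they make [K (H - 1) (K_2 - 1)] nonzero, and
    the cleared equation equates it with [- H_12 * den]
    (lemma [eq_opp_divP]).

    Only half of the equivalences are computed. Exchanging [tau] with
    [sigma] and at the same time the two lattice directions maps [H], [A], [B]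
    to [K], [Q], [P], hence turns the first Demoulin equation into the
    second one, and the relation for [B] into the one for [P]. *)

Set Implicit Arguments.
Unset Strict Implicit.
Unset Printing Implicit Defensive.

Import Order.TTheory GRing.Theory Num.Theory.
Local Open Scope ring_scope.

(** * Determinants and fractions *)

Lemma det2E (R : realType) (a b c d : R) : det2 a b c d = a * d - b * c.
Proof.
rewrite /det2 (expand_det_row _ ord0) !big_ord_recl big_ord0 /cofactor.
rewrite !det_mx11 !mxE /=.
ring.
Qed.

Lemma det2_tr (R : realType) (a b c d : R) : det2 a b c d = det2 a c b d.
Proof. by rewrite !det2E [b * c]mulrC. Qed.

Lemma det3E (R : realType) (a b c d e f g h i : R) :
  det3 a b c d e f g h i =
  a * (e * i - f * h) - b * (d * i - f * g) + c * (d * h - e * g).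
Proof.
rewrite /det3 (expand_det_row _ ord0) !big_ord_recl big_ord0 /cofactor.
rewrite !(expand_det_row _ ord0) !big_ord_recl !big_ord0 /cofactor.
rewrite !det_mx11 !mxE /=.
ring.
Qed.

(** In the cleared equation [den = 0] would force [num = 0], so that equation
    contains the nonvanishing of [den]. *)
Lemma eq_opp_divP (F : fieldType) (x num den : F) : num != 0 ->
  (den != 0 /\ x = - (num / den)) <-> x * den + num = 0.
Proof.
move=> num0; split=> [[den0 ->]|e].
  by rewrite mulNr divfK // addNr.
have den0 : den != 0.
  by apply: contra_neq num0 => d0; move: e; rewrite d0 mulr0 add0r.
split=> //; apply: (mulIf den0).
by rewrite mulNr divfK //; apply/eqP; rewrite -addr_eq0 e.
Qed.

Lemma potH_sub1 (R : realType) (h : int * int -> R) n :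
  (forall m, h m != 0) ->
  potH h n - 1 =
  - det2 (h n) (h\_1 n) (h\_2 n) (h\_12 n) / (h\_12 n * h n).
Proof.
move=> h0; rewrite det2E /potH.
by field; rewrite !h0.
Qed.

Lemma potH_neq1_det2 (R : realType) (h : int * int -> R) n :
  (forall m, h m != 0) -> potH h n != 1 ->
  det2 (h n) (h\_1 n) (h\_2 n) (h\_12 n) != 0.
Proof.
move=> h0; rewrite -subr_eq0 potH_sub1 //; apply: contra_neq => ->.
by rewrite oppr0 mul0r.
Qed.

Lemma eq_sub_scaledP (F : fieldType) (c x y u v : F) : c != 0 ->
  x - y = c * (u - v) -> x = y <-> u = v.
Proof.
move=> c0 e; split=> [xy|uv]; apply/eqP; rewrite -subr_eq0.
  by rewrite -(inj_eq (mulfI c0)) -e xy subrr mulr0.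
by rewrite e uv subrr mulr0.
Qed.

(** * Compatibility relations, the equation for H and the relation for B *)

Section Potentials.
Variables (R : realType) (tau sigma : int * int -> R).
Hypotheses (tau_neq0 : forall n, tau n != 0).
Hypotheses (sigma_neq0 : forall n, sigma n != 0).

Let H := potH tau.
Let A := potA tau sigma.
Let B := potB tau sigma.
Let K := potK sigma.
Let P := potP tau sigma.
Let Q := potQ tau sigma.

Lemma potentials_compatible n :
  [/\ A\_2 n = H\_1 n / K n * A n,
      Q\_1 n = K\_2 n / H n * Q n,
      P\_2 n = K\_1 n / H n * P n &
      B\_1 n = H\_2 n / K n * B n].
Proof.
case: n => n1 n2.
rewrite /A /Q /P /B /H /K /potA /potQ /potP /potB /potH /potK /shift1 /shift2 /=.
by split; field; rewrite ?tau_neq0 ?sigma_neq0.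
Qed.

Definition demoulin_form n : R :=
  det2 (sigma\_2 n)  (sigma\_12 n)
       (sigma\_22 n) (sigma\_122 n) *
  det3 (tau n)     (tau\_1 n)   (tau\_11 n)
       (tau\_2 n)  (tau\_12 n)  (tau\_112 n)
       (tau\_22 n) (tau\_122 n) (tau\_1122 n) +
  det2 (tau\_2 n)  (tau\_12 n)
       (tau\_22 n) (tau\_122 n) *
  (sigma\_12 n) ^+ 2 * tau\_12 n.

(** The monomial is read off from the coefficient of [tau_1122]:
    [H_12] is proportional to [1 / tau_1122], so that coefficient comes from
    [K (H - 1) (K_2 - 1)] alone. *)
Lemma potH_equation_factor n :
  H\_12 n * demoulin_denH H K A Q n + K n * (H n - 1) * (K\_2 n - 1) =
  K n / (tau\_12 n * tau n * sigma\_122 n * sigma\_2 n * tau\_1122 n) *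
  demoulin_form n.
Proof.
rewrite /demoulin_form !det2E det3E; case: n => n1 n2.
rewrite /demoulin_denH /A /Q /H /K /potA /potQ /potH /potK /shift1 /shift2 /=.
by field; rewrite ?tau_neq0 ?sigma_neq0.
Qed.

Lemma potK_neq0 n : K n != 0.
Proof.
by rewrite /K /potK mulf_neq0 ?invr_neq0 ?mulf_neq0 //; apply: sigma_neq0.
Qed.

Hypotheses (H_neq1 : forall n, H n != 1) (K_neq1 : forall n, K n != 1).

Lemma demoulin_eqH_det n :
  demoulin_eqH H K A Q n <-> demoulin_form n = 0.
Proof.
have num0 : K n * (H n - 1) * (K\_2 n - 1) != 0.
  by apply: mulf_neq0; [apply: mulf_neq0; first exact: potK_neq0|];
    rewrite subr_eq0; [apply: H_neq1 | apply: K_neq1].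
rewrite /demoulin_eqH eq_opp_divP // potH_equation_factor.
have c0 : K n / (tau\_12 n * tau n * sigma\_122 n * sigma\_2 n * tau\_1122 n)
            != 0.
  apply: mulf_neq0; first exact: potK_neq0.
  by rewrite invr_neq0 ?mulf_neq0 // ?tau_neq0 ?sigma_neq0.
split=> [/eqP|->]; last by rewrite mulr0.
by rewrite mulf_eq0 (negbTE c0) => /eqP.
Qed.

(** The right-hand side of the relation is [B] times the ratio of the
    right-hand side of the determinant equation to its left-hand side [L].
    Hence the difference of the two sides of the relation is [B / L] times the
    difference of the two determinant products; [L <> 0] because its two
    determinants vanish only where [H = 1] or [K_2 = 1]. *)
Lemma relationB_det n :
  B n = ((H\_2 n - 1) * (K n - 1) * K\_2 n) /
        ((H n - 1) * (K\_2 n - 1) * H\_2 n) * Q n <->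
  det2 (tau n)    (tau\_1 n)
       (tau\_2 n) (tau\_12 n) *
  det2 (sigma\_2 n)  (sigma\_22 n)
       (sigma\_12 n) (sigma\_122 n) =
  det2 (sigma n)    (sigma\_1 n)
       (sigma\_2 n) (sigma\_12 n) *
  det2 (tau\_2 n)  (tau\_22 n)
       (tau\_12 n) (tau\_122 n).
Proof.
case: n => n1 n2.
have := potH_neq1_det2 tau_neq0 (H_neq1 (n1, n2)).
have := potH_neq1_det2 sigma_neq0 (K_neq1 (n1, n2 + 1)).
rewrite !det2E /B /Q /H /K /potB /potQ /potH /potK /shift1 /shift2 /=.
move=> DK DH.
pose L :=
  (tau (n1, n2) * tau (n1 + 1, n2 + 1) - tau (n1 + 1, n2) * tau (n1, n2 + 1)) *
  (sigma (n1, n2 + 1) * sigma (n1 + 1, n2 + 1 + 1)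
   - sigma (n1 + 1, n2 + 1) * sigma (n1, n2 + 1 + 1)).
apply: (@eq_sub_scaledP _ (potB tau sigma (n1, n2) / L)).
  by rewrite mulf_neq0 ?invr_neq0 ?mulf_neq0 ?invr_neq0 ?mulf_neq0 //
     ?tau_neq0 ?sigma_neq0.
rewrite /L /potB /shift1 /shift2 /=.
have oppr_neq0 (x y : R) : y != 0 -> x = - y -> x != 0.
  by move=> y0 ->; rewrite oppr_eq0.
(* Up to order of factors, [field] asks for DK and DH and for the
   nonvanishing of their opposites, which are the numerators of [H - 1] and
   [K_2 - 1]. *)
field; rewrite DK DH ?tau_neq0 ?sigma_neq0 ?andbT /=.
by apply/andP; split; [apply: (oppr_neq0 _ _ DK)|apply: (oppr_neq0 _ _ DH)]; ring.
Qed.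

End Potentials.

(** * The symmetry exchanging tau with sigma and the lattice directions *)

Definition transpose (T : Type) (h : int * int -> T) : int * int -> T :=
  fun n => h (n.2, n.1).

Section Symmetry.
Variables (R : realType) (tau sigma : int * int -> R).

Let tau' := transpose sigma.
Let sigma' := transpose tau.

Lemma potH_transpose (h : int * int -> R) n :
  potH (transpose h) n = potH h (n.2, n.1).
Proof. by congr (_ / _); apply: mulrC. Qed.

Lemma potA_transpose n : potA tau' sigma' n = potQ tau sigma (n.2, n.1).
Proof. by []. Qed.

Lemma potQ_transpose n : potQ tau' sigma' n = potA tau sigma (n.2, n.1).
Proof. by []. Qed.

Lemma potB_transpose n : potB tau' sigma' n = potP tau sigma (n.2, n.1).
Proof. by []. Qed.

(** The symmetry fixes [A Q H_1 K_2] and exchanges everything else in the two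
    denominators. *)
Lemma demoulin_eqK_transpose n1 n2 :
  demoulin_eqK (potH tau) (potK sigma) (potA tau sigma) (potQ tau sigma)
    (n1, n2) <->
  demoulin_eqH (potH tau') (potK sigma') (potA tau' sigma') (potQ tau' sigma')
    (n2, n1).
Proof.
(* [potK] is [potH] with another name for its argument, so that
   [potH_transpose] serves for both. *)
rewrite -[@potK R]/(@potH R) /demoulin_eqK /demoulin_eqH.
have -> : demoulin_denH (potH tau') (potH sigma') (potA tau' sigma')
            (potQ tau' sigma') (n2, n1) =
          demoulin_denK (potH tau) (potH sigma) (potA tau sigma)
            (potQ tau sigma) (n1, n2).
  rewrite /demoulin_denH /demoulin_denK /shift1 /shift2.
  rewrite potA_transpose potQ_transpose !potH_transpose /=.
  ring.
by rewrite /shift1 /shift2 !potH_transpose.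
Qed.

End Symmetry.

Theorem mainTheorem9 (R : realType) (tau sigma : int * int -> R)
    (tau_neq0 : forall n, tau n != 0) (sigma_neq0 : forall n, sigma n != 0) :
  let H := potH tau in
  let A := potA tau sigma in
  let B := potB tau sigma in
  let K := potK sigma in
  let P := potP tau sigma in
  let Q := potQ tau sigma in
  (forall n,
    [/\ A\_2 n = H\_1 n / K n * A n,
        Q\_1 n = K\_2 n / H n * Q n,
        P\_2 n = K\_1 n / H n * P n &
        B\_1 n = H\_2 n / K n * B n]) /\
  ((forall n, H n != 1) -> (forall n, K n != 1) -> forall n,
    [/\ demoulin_eqH H K A Q n <->
          det2 (sigma\_2 n)  (sigma\_12 n)
               (sigma\_22 n) (sigma\_122 n) *
          det3 (tau n)     (tau\_1 n)   (tau\_11 n)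
               (tau\_2 n)  (tau\_12 n)  (tau\_112 n)
               (tau\_22 n) (tau\_122 n) (tau\_1122 n) +
          det2 (tau\_2 n)  (tau\_12 n)
               (tau\_22 n) (tau\_122 n) *
          (sigma\_12 n) ^+ 2 * tau\_12 n = 0,
        demoulin_eqK H K A Q n <->
          det2 (tau\_1 n)  (tau\_11 n)
               (tau\_12 n) (tau\_112 n) *
          det3 (sigma n)     (sigma\_2 n)   (sigma\_22 n)
               (sigma\_1 n)  (sigma\_12 n)  (sigma\_122 n)
               (sigma\_11 n) (sigma\_112 n) (sigma\_1122 n) +
          det2 (sigma\_1 n)  (sigma\_11 n)
               (sigma\_12 n) (sigma\_112 n) *
          (tau\_12 n) ^+ 2 * sigma\_12 n = 0,
        B n = ((H\_2 n - 1) * (K n - 1) * K\_2 n) /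
              ((H n - 1) * (K\_2 n - 1) * H\_2 n) * Q n <->
          det2 (tau n)    (tau\_1 n)
               (tau\_2 n) (tau\_12 n) *
          det2 (sigma\_2 n)  (sigma\_22 n)
               (sigma\_12 n) (sigma\_122 n) =
          det2 (sigma n)    (sigma\_1 n)
               (sigma\_2 n) (sigma\_12 n) *
          det2 (tau\_2 n)  (tau\_22 n)
               (tau\_12 n) (tau\_122 n) &
        P n = ((H n - 1) * (K\_1 n - 1) * H\_1 n) /
              ((H\_1 n - 1) * (K n - 1) * K\_1 n) * A n <->
          det2 (tau n)    (tau\_1 n)
               (tau\_2 n) (tau\_12 n) *
          det2 (sigma\_1 n)  (sigma\_11 n)
               (sigma\_12 n) (sigma\_112 n) =
          det2 (sigma n)    (sigma\_1 n)
               (sigma\_2 n) (sigma\_12 n) *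
          det2 (tau\_1 n)  (tau\_11 n)
               (tau\_12 n) (tau\_112 n)]).
Proof.
move=> H A B K P Q; split; first exact: potentials_compatible.
move=> H_neq1 K_neq1 [n1 n2].
have tau'_neq0 m : transpose sigma m != 0 by apply: sigma_neq0.
have sigma'_neq0 m : transpose tau m != 0 by apply: tau_neq0.
have H'_neq1 m : potH (transpose sigma) m != 1.
  by rewrite potH_transpose; apply: K_neq1.
have K'_neq1 m : potK (transpose tau) m != 1.
  by rewrite -[potK _]/(potH _) potH_transpose; apply: H_neq1.
split.
- exact: demoulin_eqH_det.
- rewrite demoulin_eqK_transpose demoulin_eqH_det //.
  rewrite /demoulin_form /transpose /shift1 /shift2 /=.
  by rewrite -(det2_tr (tau (n1 + 1, n2))) -(det2_tr (sigma (n1 + 1, n2))).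
- exact: relationB_det.
- have := relationB_det tau'_neq0 sigma'_neq0 H'_neq1 K'_neq1 (n2, n1).
  rewrite /shift1 /shift2 -[@potK R]/(@potH R) potB_transpose potQ_transpose.
  rewrite !potH_transpose /transpose /= => relP.
  rewrite [(H _ - 1) * _]mulrC [(H _ - 1) * (K (n1, n2) - 1)]mulrC.
  rewrite (det2_tr (tau (n1, n2))) (det2_tr (sigma (n1, n2))).
  by apply: (iff_trans relP); split=> ->.
Qed.
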